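(* If $(\Delta_n)_{n\in\mathbb{N}}$ is a $\operatorname{Sym}$-invariant chain of simplicial complexes, $\Delta_n$ on vertex set $V_n=[n]^c$, then there is some integer $n_0$ such that the $\operatorname{Sym}(n+1)$-orbit of the cone over $\Delta_n$ with apices $V_{n+1}-V_n$ equals $\Delta_{n+1}$ whenever $n\ge n_0$; that is, $$\Delta_{n+1}=\{\sigma(F\cup G)\mid \sigma\in\operatorname{Sym}(n+1),\ F\in\Delta_n,\ G\subseteq V_{n+1}-V_n\}\quad\text{for all }n\ge n_0.$$
   Context: $\mathbb{N}$ denotes the positive integers and $[n]=\{1,\dots,n\}$. Fix $c\in\mathbb{N}$. Let $V_n=[n]^c:=\{j_i\mid i\in[c],\ j\in[n]\}$ ($c$ disjoint copies of $[n]$), so $V_m\subseteq V_n$ for $m\le n$; $\operatorname{Sym}(n)$ acts on $V_n$ by $\sigma\cdot j_i=(\sigma(j))_i$. A sequence $(\Delta_n)_{n\in\mathbb{N}}$ of simplicial complexes, $\Delta_n$ on vertex set $V_n$, is a $\operatorname{Sym}$-invariant chain if (1) for all $m\le n$, every $\sigma\in\operatorname{Sym}(n)$ maps every face of $\Delta_m$ onto a face of $\Delta_n$, and (2) for every $n$ the $c$-fold cone over $\Delta_n$ with apices $V_{n+1}-V_n$, i.e. $\{F\cup G\mid F\in\Delta_n,\ G\subseteq V_{n+1}-V_n\}$, is contained in $\Delta_{n+1}$. *)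

(* Defs.v *)
From mathcomp Require Import all_boot all_fingroup.

Set Implicit Arguments.
Unset Strict Implicit.
Unset Printing Implicit Defensive.

(* The vertex set V_n = [n]^c (c disjoint copies of [n]): the vertex j_i is the
   pair (i, j), and [n] is represented 0-based by 'I_n = {0, ..., n-1}. *)
Definition vertex (c n : nat) : finType := ('I_c * 'I_n)%type.

Definition vwiden (c m n : nat) (le_mn : m <= n) (x : vertex c m) :
  vertex c n := (x.1, widen_ord le_mn x.2).

Definition vperm (c n : nat) (s : 'S_n) (x : vertex c n) : vertex c n :=
  (x.1, s x.2).

(* A simplicial complex on the ground set T, given by its set of faces.
   Elements of T need not be faces, and the void complex is allowed. *)
Definition simplicial_complex (T : finType) (D : {set {set T}}) : Prop :=
  forall F G : {set T}, F \in D -> G \subset F -> G \in D.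

Definition apices (c n : nat) : {set vertex c n.+1} :=
  ~: [set vwiden (leqnSn n) x | x : vertex c n].

Definition cone (c n : nat) (D : {set {set vertex c n}}) :
  {set {set vertex c n.+1}} :=
  [set [set vwiden (leqnSn n) x | x in F] :|: G
     | F : {set vertex c n} in D,
       G : {set vertex c n.+1} in powerset (apices c n)].

Definition sym_orbit (c n : nat) (D : {set {set vertex c n}}) :
  {set {set vertex c n}} :=
  [set [set vperm s x | x in F]
     | s : 'S_n, F : {set vertex c n} in D].

(* Chains are indexed by the positive integers: Delta 0 is a dummy value on
   which no condition is imposed. *)
Record sym_invariant_chain (c : nat)
    (Delta : forall n : nat, {set {set vertex c n}}) : Prop :=
  SymInvariantChain {
    chain_complex : forall n : nat, 0 < n -> simplicial_complex (Delta n);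
    chain_sym : forall (m n : nat) (le_mn : m <= n) (s : 'S_n)
        (F : {set vertex c m}),
      0 < m -> F \in Delta m ->
      [set vperm s x | x in [set vwiden le_mn y | y in F]] \in Delta n;
    chain_cone : forall n : nat, 0 < n -> cone (Delta n) \subset Delta n.+1
  }.

(* Main.v *)
(** Up to the action of Sym(n), a set of vertices F of V_n is determined by its
    profile, which counts for every T in 2^[c] the columns j of [n] whose fiber
    {i | j_i in F} is T. Passing to the cone over Delta_n raises one coordinate
    of a profile by one, in any direction T. By Dickson's lemma the profiles of
    all faces of all Delta_n lie above those of the faces of Delta_m, m <= n0;
    so if n >= n0, a face of Delta_(n+1) is obtained up to symmetry from a face
    of some Delta_m with m <= n by iterated cones, the last being over Delta_n. *)
Require Import Defs.
From mathcomp Require Import all_boot all_fingroup.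
From Stdlib Require Import Classical_Prop.

Set Implicit Arguments.
Unset Strict Implicit.
Unset Printing Implicit Defensive.

(* The free coordinates S decrease in the induction: an element of P that is not
   above a fixed a0 in P has some coordinate i with value v < a0 i, and so lies
   in one of finitely many slices of P in which i is no longer free. *)
Lemma dickson_free (I : finType) (S : {set I}) (P : (I -> nat) -> Prop) :
  (forall a b, P a -> P b -> forall i, i \notin S -> a i = b i) ->
  exists N, forall a, P a ->
    exists2 b, P b & (forall i, b i <= a i) /\ \sum_i b i <= N.
Proof.
have [k] := ubnP #|S|; elim: k => // k IHk in S P *; rewrite ltnS => leSk agreeP.
have [[a0 Pa0]|noP] := classic (exists a, P a); last first.
  by exists 0 => a Pa; case: noP; exists a.
(* Every [v < a0 i] lies below [\sum_i a0 i], so this common bound makes the pairs of a coordinate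
   and a value range over one finite type. *)
have slice (iv : I * 'I_(\sum_i a0 i)) : exists N, forall a,
    P a /\ iv.1 \in S /\ a iv.1 = iv.2 ->
    exists2 b, P b /\ iv.1 \in S /\ b iv.1 = iv.2
             & (forall i, b i <= a i) /\ \sum_i b i <= N.
  case: iv => i v /=; have [Si|S'i] := boolP (i \in S); last first.
    by exists 0 => a [_ []].
  apply: (IHk (S :\ i)) => [|a b [Pa [_ ai]] [Pb [_ bi]] j].
    by move: leSk; rewrite (cardsD1 i S) Si.
  rewrite in_setD1 negb_and negbK => /orP[/eqP->|]; first by rewrite ai bi.
  exact: agreeP.
have [N leN] := fin_all_exists slice.
exists (\sum_i a0 i + \sum_iv N iv) => a Pa.
have [le_a|] := boolP [forall i, a0 i <= a i].
  by exists a0 => //; split; [apply/forallP | apply: leq_addr].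
rewrite negb_forall => /existsP[i]; rewrite -ltnNge => lt_ai.
have lt_a : a i < \sum_i a0 i by rewrite (bigD1 i) //= ltn_addr.
have Si : i \in S.
  by apply: contraLR lt_ai => S'i; rewrite (agreeP _ _ Pa Pa0 _ S'i) ltnn.
have [//|b [Pb _] [le_ba le_b]] := leN (i, Ordinal lt_a) a.
exists b => //; split=> //; apply: leq_trans le_b _.
by rewrite (bigD1 (i, Ordinal lt_a)) //= addnCA leq_addr.
Qed.

(** The bound on the coordinate sum expresses that finitely many minimal elements suffice; for a
    profile, this sum is the level of the face. *)
Lemma dickson (I : finType) (P : (I -> nat) -> Prop) :
  exists N, forall a, P a ->
    exists2 b, P b & (forall i, b i <= a i) /\ \sum_i b i <= N.
Proof. by apply: (@dickson_free _ setT) => a b _ _ i; rewrite inE. Qed.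

Section Profile.

Variable c : nat.

Definition fiber n (F : {set vertex c n}) (j : 'I_n) : {set 'I_c} :=
  [set i | (i, j) \in F].

Definition profile n (F : {set vertex c n}) (T : {set 'I_c}) : nat :=
  \sum_(j < n) (fiber F j == T).

Lemma sum_profile n (F : {set vertex c n}) : \sum_T profile F T = n.
Proof.
rewrite exchange_big /= -[RHS]card_ord -sum1_card; apply: eq_bigr => j _.
rewrite (bigD1 (fiber F j)) //= eqxx big1 // => T.
by rewrite eq_sym => /negPf->.
Qed.

(** Equal profiles make the two lists of fibers rearrangements of each other, and the permutation of
    positions also permutes the columns. *)
Lemma profile_inj_sym n (F G : {set vertex c n}) :
  profile F =1 profile G -> exists s : 'S_n, G = [set vperm s x | x in F].
Proof.
move=> eqFG; pose fibers H := [tuple fiber H j | j < n].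
have countE (H : {set vertex c n}) T : count_mem T (fibers H) = profile H T.
  by rewrite count_map -sum1_count big_mkcond big_enum; apply: eq_bigr.
have /tuple_permP[s sE] : perm_eq (fibers F) (fibers G).
  by apply/allP=> T _ /=; rewrite !countE eqFG.
have fibE j : fiber F j = fiber G (s j).
  by have /(congr1 (fun t => tnth t j)) := val_inj sE; rewrite !tnth_mktuple.
have memE i j : ((i, j) \in F) = ((i, s j) \in G).
  by have /setP/(_ i) := fibE j; rewrite !inE.
exists s; apply/setP => -[i j]; apply/idP/imsetP => [Gij|[[i' j'] Fx [-> ->]]].
  by exists (i, (s^-1)%g j); rewrite ?memE /vperm /= permKV.
by rewrite -memE.
Qed.

Definition extend n (F : {set vertex c n}) (T : {set 'I_c}) :
    {set vertex c n.+1} :=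
  [set vwiden (leqnSn n) x | x in F] :|: [set (i, ord_max) | i in T].

Lemma ord_max_apices n i : (i, ord_max) \in apices c n.
Proof.
rewrite inE; apply/imsetP => -[[i' j] _ [_ nj]].
by have := ltn_ord j; rewrite -nj ltnn.
Qed.

Lemma extend_cone n (D : {set {set vertex c n}}) F T :
  F \in D -> extend F T \in cone D.
Proof.
move=> DF; apply: imset2_f => //; rewrite powersetE.
by apply/subsetP => _ /imsetP[i _ ->]; apply: ord_max_apices.
Qed.

Lemma fiber_extend_widen n (F : {set vertex c n}) T j :
  fiber (extend F T) (widen_ord (leqnSn n) j) = fiber F j.
Proof.
apply/setP => i; rewrite !inE.
rewrite (mem_imset _ (i, j) (f := vwiden (leqnSn n))); last first.
  by move=> [i1 j1] [i2 j2] [-> /val_inj->].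
case: imsetP => [[i' _ [_ jn]]|_]; last exact: orbF.
by have := ltn_ord j; rewrite jn ltnn.
Qed.

Lemma fiber_extend_max n (F : {set vertex c n}) T :
  fiber (extend F T) ord_max = T.
Proof.
apply/setP => i; rewrite !inE mem_imset; last by move=> i1 i2 [].
case: (imsetP (D := mem F)) => [[x _ eqx]|//].
by have := ord_max_apices n i; rewrite inE eqx imset_f.
Qed.

Lemma profile_extend n (F : {set vertex c n}) T U :
  profile (extend F T) U = profile F U + (T == U).
Proof.
rewrite /profile big_ord_recr fiber_extend_max; congr (_ + _).
by apply: eq_bigr => j _; rewrite fiber_extend_widen.
Qed.

(** The coordinates of the profile sum to [n], so some coordinate [T] is strictly below [a T]; the
    new column is given that fiber. *)
Lemma extend_profile_le n (F : {set vertex c n}) (a : {set 'I_c} -> nat) :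
    (forall T, profile F T <= a T) -> n < \sum_T a T ->
  exists T, forall U, profile (extend F T) U <= a U.
Proof.
move=> le_a lt_n.
have [T lt_T] : exists T, profile F T < a T.
  apply/existsP; apply: contraLR lt_n; rewrite negb_exists => /forallP ge_a.
  rewrite -leqNgt -[leqRHS](sum_profile F); apply: leq_sum => T _.
  by rewrite leqNgt.
exists T => U; rewrite profile_extend.
by have [<-|_] := eqVneq; rewrite ?addn1 ?addn0.
Qed.

End Profile.

Section Chain.

Variables (c : nat) (Delta : forall n : nat, {set {set vertex c n}}).
Hypothesis chainD : sym_invariant_chain Delta.

Lemma sym_orbit_cone_sub n :
  0 < n -> sym_orbit (cone (Delta n)) \subset Delta n.+1.
Proof.
move=> n_gt0; apply/subsetP => _ /imset2P[s F _ coneF ->].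
have /(chain_sym chainD (leqnn _) s (ltn0Sn n)) :=
  subsetP (chain_cone chainD n_gt0) _ coneF.
(* Invariance at equal levels still passes through [vwiden (leqnn _)], which is the identity. *)
have vwiden_id : vwiden (leqnn n.+1) =1 @id (vertex c n.+1).
  by case=> i j; congr (_, _); apply: val_inj.
by rewrite (eq_imset _ vwiden_id) imset_id.
Qed.

(** Iterated cones lead from level [m] to level [n]; below level [n] the profile still has room
    under [a]. *)
Lemma chain_profile_le m n (F : {set vertex c m}) (a : {set 'I_c} -> nat) :
    0 < m -> m <= n -> F \in Delta m -> (forall T, profile F T <= a T) ->
    n <= \sum_T a T ->
  exists2 G, G \in Delta n & forall T, profile G T <= a T.
Proof.
move=> m_gt0 /subnKC <-; move: (n - m) => k {n} DF le_a.
elim: k => [|k IHk]; first by rewrite addn0; exists F.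
rewrite addnS => lt_k; have [G DG le_G] := IHk (ltnW lt_k).
have [T le_T] := extend_profile_le le_G lt_k.
exists (extend G T) => //; apply: (subsetP (chain_cone chainD _)).
  by rewrite addn_gt0 m_gt0.
exact: extend_cone.
Qed.

End Chain.

Theorem proposition3p17 (c : nat) (c_gt0 : 0 < c)
    (Delta : forall n : nat, {set {set vertex c n}})
    (chainD : sym_invariant_chain Delta) :
  exists n0 : nat, forall n : nat, 0 < n -> n0 <= n ->
    Delta n.+1 = sym_orbit (cone (Delta n)).
Proof.
have [n0 leD] := dickson (fun a : {set 'I_c} -> nat =>
  exists m (F : {set vertex c m}), [/\ 0 < m, F \in Delta m & a = profile F]).
exists n0 => n n_gt0 le_n; apply/eqP; rewrite eqEsubset sym_orbit_cone_sub //.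
rewrite andbT; apply/subsetP => A DA.
have [|_ [m [F [m_gt0 DF ->]]] [le_F]] := leD (profile A).
  by exists n.+1, A.
(* The sum bounded by Dickson's lemma is the level [m] of [F], whence [m <= n0 <= n]. *)
rewrite sum_profile => /leq_trans/(_ le_n) le_mn.
have [|G DG le_G] := chain_profile_le chainD m_gt0 le_mn DF le_F.
  by rewrite sum_profile.
have [|T le_T] := extend_profile_le le_G; first by rewrite sum_profile.
(* Both profiles sum to [n.+1], so the coordinatewise inequality is an equality. *)
have /profile_inj_sym[s ->] : profile (extend G T) =1 profile A.
  have [_] := leqif_sum (fun U (_ : true) => leqif_eq (le_T U)).
  by rewrite !sum_profile eqxx => /esym/forallP eqT U; apply/eqP/eqT.
by apply: imset2_f; rewrite ?inE ?extend_cone.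
Qed.
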